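(* Let $W_n=\{\alpha\in[0,1]:\ \alpha n\in\mathbb N \text{ and } \tfrac{1-\alpha}{2}n\in\mathbb N\}$. The Three-Phase auction (defined in the context) is a value-strategyproof and time-strategyproof online auction that, given any parameter $\alpha\in W_n$, simultaneously guarantees $\alpha$-consistency and $\frac{1-\alpha^2}{4}$-robustness; that is, $\text{consistency}(M)\ge\alpha$ and $\text{robustness}(M)\ge\frac{1-\alpha^2}{4}$, where $M$ denotes the Three-Phase auction with parameter $\alpha$.
   Context: **Model.** A single item is sold to a set $N=\{1,\dots,n\}$ of bidders. Bidder $i$ has a private type $\theta_i=(a_i,d_i,v_i)$ with arrival time $a_i$, departure time $d_i\ge a_i$ and value $v_i$ for the item. Bidder $i$ may misreport her value, may delay the announcement of her arrival (report $\hat a_i> a_i$, but never earlier than $a_i$), and may report a false departure time $\hat d_i$ (earlier or later than $d_i$). If the item is allocated to a bidder $i$ at time $t$ at price $p$, her utility is $v_i-p$ if $t\in[a_i,d_i]$ and $-p$ otherwise; all other bidders have utility $0$. An auction is strategyproof if for every bidder truthfully reporting her type is a dominant strategy, i.e., maximizes her utility whatever types the others report; value-strategyproofness means bidders cannot benefit from misreporting their value, and time-strategyproofness is the additional requirement that they cannot benefit from misreporting arrival or departure times either. An auction is online if a decision to allocate at time $t$ is irrevocable, and this decision and the payment depend only on information about bidders with arrival time at most $t$. Bidders are indexed by order of departure (bidder $i$ is the $i$-th to depart). An arbitrary fixed total order $\pi$ on bidders is used for tie-breaking; $i\succ j$ means $i$ is ranked before $j$ in $\pi$. **Consistency and robustness.**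 A set $V$ of $n$ values, with highest value $v_{(1)}$ and second-highest value $v_{(2)}$, and a set $I=\{[a_1,d_1],\dots,[a_n,d_n]\}$ of $n$ arrival-departure intervals are chosen adversarially; $\mu(V,I)$ is the random type profile $\Theta$ obtained by matching values to intervals uniformly at random. The auction is also given a prediction $\tilde v_{(1)}\ge 0$ of $v_{(1)}$. $\mathrm{Rev}(M(\Theta,\tilde v_{(1)}))$ is the revenue of auction $M$ on type profile $\Theta$ with prediction $\tilde v_{(1)}$. Then $$\text{consistency}(M)=\min_{V,I}\frac{\mathbb E_{\Theta\sim\mu(V,I)}[\mathrm{Rev}(M(\Theta,v_{(1)}))]}{v_{(1)}},\qquad \text{robustness}(M)=\min_{V,I,\tilde v_{(1)}}\frac{\mathbb E_{\Theta\sim\mu(V,I)}[\mathrm{Rev}(M(\Theta,\tilde v_{(1)}))]}{v_{(2)}}.$$ **Three-Phase auction with parameter $\alpha$ and prediction $\tilde v_{(1)}$.** *Allocation rule, $\textsc{Alloc}(n,\Theta,\alpha,\tilde v_{(1)})$, for $n$ bidders with types $\Theta$.* Initialize: active set $A=\emptyset$, departed set $L=\emptyset$, $v_{\max}=0$, threshold $\tau=\infty$, winner $i^*=0$, flag active-winner $=$ false. While not all bidders have departed, process the events over time: - If some bidder $i$ arrives (ties broken by $\pi$): add $i$ to $A$; if $v_i\ge\tau$, set $i^*=i$ and stop the loop. - Else, if some bidder $i$ departs (ties broken by $\pi$): move $i$ from $A$ to $L$ and set $v_{\max}\leftarrow\max\{v_{\max},v_i\}$. Then, if $|L|=\lceil\frac{1-\alpha}{2}n\rceil$,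 set $\tau\leftarrow\max\{v_{\max},\tilde v_{(1)}\}$ (start of the second phase); else if $|L|=\lfloor\frac{1+\alpha}{2}n\rfloor$, set $\tau\leftarrow v_{\max}$ (start of the third phase). Then, if there is a bidder $i\in A$ with $v_i\ge\tau$, set active-winner $=$ true, set $i^*$ to such a bidder (ties broken by $\pi$) and stop the loop. Return $i^*$, $\tau$, active-winner. *Payment rule.* Given the output $i^*,\tau$, active-winner of $\textsc{Alloc}(n,\Theta,\alpha,\tilde v_{(1)})$, set $p=\tau$. If $\tau=\tilde v_{(1)}$ and $i^*>\lfloor\frac{1+\alpha}{2}n\rfloor$, run the simulation without $i^*$, $(i',\tau',\text{active-winner}')=\textsc{Alloc}(n-1,\Theta_{-i^*},\alpha,\tilde v_{(1)})$, where $\Theta_{-i^*}$ is the profile with $i^*$ removed; if active-winner$'$ is false or $i^*\succ i'$, set $p=\tau'$. The winner $i^*$ (if any) receives the item at her reported departure time and pays $p$.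
   Formalization: The literal auction fails the claim, so it is amended: the simulation without i* keeps the n-bidder phase boundaries, not those of n−1; if α=1 the second phase starts at once, before any departure; if α=0 the third-phase test takes priority. *)

(* Defs.v *)
From mathcomp Require Import all_boot all_order all_algebra all_fingroup.
From mathcomp Require Import boolp classical_sets reals ereal.
Set Implicit Arguments.
Unset Strict Implicit.
Unset Printing Implicit Defensive.
Import Order.TTheory GRing.Theory Num.Theory.
Local Open Scope ring_scope.

Record btype (R : realType) := BType { arr : R; dep : R; value : R }.

Definition valid_type (R : realType) (th : btype R) : Prop :=
  arr th <= dep th /\ 0 <= value th.

Definition profile (R : realType) (n : nat) := 'I_n -> btype R.

Definition valid_profile (R : realType) n (Th : profile R n) : Prop :=
  forall i, valid_type (Th i).

Definition report (R : realType) n (Th : profile R n) (i : 'I_n) (th : btype R)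
  : profile R n := [eta Th with i |-> th].

Record outcome (R : realType) (n : nat) :=
  Outcome { winner : 'I_n; alloc_time : R; price : R }.

(** [None] means that the item is not sold. *)
Definition auction (R : realType) (n : nat) :=
  profile R n -> option (outcome R n).

Definition utility (R : realType) n (th : btype R) (o : option (outcome R n))
    (i : 'I_n) : R :=
  if o is Some w then
    if winner w == i then
      (if arr th <= alloc_time w <= dep th then value th else 0) - price w
    else 0
  else 0.

Definition revenue (R : realType) n (o : option (outcome R n)) : R :=
  if o is Some w then price w else 0.

Definition value_strategyproof (R : realType) n (M : auction R n) : Prop :=
  forall (Th : profile R n) (i : 'I_n) (v : R),
    valid_profile Th -> 0 <= v ->
    utility (Th i) (M (report Th i (BType (arr (Th i)) (dep (Th i)) v))) i
      <= utility (Th i) (M Th) i.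

(** Arrival, departure and value may be misreported jointly; the arrival can
    only be delayed, and the reported departure may be early or late. *)
Definition time_strategyproof (R : realType) n (M : auction R n) : Prop :=
  forall (Th : profile R n) (i : 'I_n) (th : btype R),
    valid_profile Th -> valid_type th -> arr (Th i) <= arr th ->
    utility (Th i) (M (report Th i th)) i <= utility (Th i) (M Th) i.

(** Two profiles carry the same information at time [t] when the same bidders
    have arrived by [t], with the same types. *)
Definition same_info (R : realType) n (t : R) (Th Th' : profile R n) : Prop :=
  forall j, arr (Th j) <= t \/ arr (Th' j) <= t -> Th j = Th' j.

Definition online (R : realType) n (M : auction R n) : Prop :=
  forall (Th Th' : profile R n) (i : 'I_n) (t p : R),
    valid_profile Th -> valid_profile Th' -> same_info t Th Th' ->
    M Th = Some (Outcome i t p) -> M Th' = Some (Outcome i t p).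

(** [kth_highest V 1] and [kth_highest V 2] are the highest and second-highest
    values, counted with multiplicity. *)
Definition kth_highest (R : realType) n (V : 'I_n -> R) (k : nat) : R :=
  nth 0 (sort >=%R (codom V)) k.-1.

Definition valid_values (R : realType) n (V : 'I_n -> R) : Prop :=
  forall i, 0 <= V i.

Definition valid_intervals (R : realType) n (I : 'I_n -> R * R) : Prop :=
  forall i, (I i).1 <= (I i).2.

(** Bidder [i] has interval [I i] and is matched to the value [V (s i)]. *)
Definition matching (R : realType) n (V : 'I_n -> R) (I : 'I_n -> R * R)
    (s : 'S_n) : profile R n :=
  fun i => BType (I i).1 (I i).2 (V (s i)).

Definition expected_revenue (R : realType) n (M : auction R n)
    (V : 'I_n -> R) (I : 'I_n -> R * R) : R :=
  (\sum_(s : 'S_n) revenue (M (matching V I s))) / n`!%:R.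

(** [M pr] is the auction run with prediction [pr]. The ratios are taken over
    the instances for which the benchmark in the denominator is positive. *)
Definition consistency (R : realType) n (M : R -> auction R n) : \bar R :=
  ereal_inf [set x | exists (V : 'I_n -> R) (I : 'I_n -> R * R),
    [/\ valid_values V, valid_intervals I, 0 < kth_highest V 1 &
        x = (expected_revenue (M (kth_highest V 1)) V I
               / kth_highest V 1)%:E]]%classic.

Definition robustness (R : realType) n (M : R -> auction R n) : \bar R :=
  ereal_inf [set x | exists (V : 'I_n -> R) (I : 'I_n -> R * R) (pr : R),
    [/\ valid_values V, valid_intervals I, 0 <= pr, 0 < kth_highest V 2 &
        x = (expected_revenue (M pr) V I / kth_highest V 2)%:E]]%classic.

(** The tie-breaking order is given by ranks: [i] is ranked before [j] when
    [pi i < pi j]. *)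
Definition before n (pi : 'S_n) (i j : 'I_n) : bool := (pi i < pi j)%N.

Definition pi_first n (pi : 'S_n) (B : {set 'I_n}) : option 'I_n :=
  [pick i in B | [forall j in B, (pi i <= pi j)%N]].

(** [inl i] is the arrival of [i], [inr i] its departure. *)
Definition event (n : nat) := ('I_n + 'I_n)%type.

(** Events are ordered by time; simultaneous arrivals come before simultaneous
    departures, and remaining ties are broken by [pi]. *)
Definition event_key (R : realType) n (pi : 'S_n) (Th : profile R n)
    (e : event n) : (R *l (bool *l 'I_n))%type :=
  match e with
  | inl i => (arr (Th i), (false, pi i))
  | inr i => (dep (Th i), (true, pi i))
  end.

Definition event_le (R : realType) n (pi : 'S_n) (Th : profile R n) :
  rel (event n) := fun e f => (event_key pi Th e <= event_key pi Th f)%O.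

Definition events (R : realType) n (pi : 'S_n) (Th : profile R n)
    (S : {set 'I_n}) : seq (event n) :=
  sort (event_le pi Th) ([seq inl i | i in S] ++ [seq inr i | i in S]).

(** The position (from 1) of [i] in the order of departures. *)
Definition dep_rank (R : realType) n (pi : 'S_n) (Th : profile R n)
    (i : 'I_n) : nat :=
  #|[set j | event_le pi Th (inr j) (inr i)]|.

Definition second_start (R : realType) (alpha : R) (n : nat) : nat :=
  `|Num.ceil ((1 - alpha) / 2 * n%:R)|%N.

Definition third_start (R : realType) (alpha : R) (n : nat) : nat :=
  `|Num.floor ((1 + alpha) / 2 * n%:R)|%N.

(** The threshold after [l] departures, given the previous threshold [tau].
    When the second phase is empty ([alpha = 0]), the third phase starts. *)
Definition next_tau (R : realType) (n : nat) (alpha pr : R) (l : nat)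
    (vmax : R) (tau : \bar R) : \bar R :=
  if l == third_start alpha n then vmax%:E
  else if l == second_start alpha n then (Num.max vmax pr)%:E
  else tau.

(** Winner (if any), threshold, and active-winner flag; [A] and [L] are the
    active and the departed bidders. *)
Fixpoint alloc_loop (R : realType) n (pi : 'S_n) (alpha pr : R)
    (Th : profile R n) (A L : {set 'I_n}) (vmax : R) (tau : \bar R)
    (es : seq (event n)) : option 'I_n * \bar R * bool :=
  match es with
  | [::] => (None, tau, false)
  | inl i :: es' =>
      if (tau <= (value (Th i))%:E)%E then (Some i, tau, false)
      else alloc_loop pi alpha pr Th (i |: A) L vmax tau es'
  | inr i :: es' =>
      let A' := A :\ i in
      let L' := i |: L in
      let vmax' := Num.max vmax (value (Th i)) in
      let tau' := next_tau n alpha pr #|L'| vmax' tau in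
      if pi_first pi [set j in A' | (tau' <= (value (Th j))%:E)%E] is Some j
      then (Some j, tau', true)
      else alloc_loop pi alpha pr Th A' L' vmax' tau' es'
  end.

(** The allocation rule run on the bidders in [S]. Two conventions matter:
    - a phase whose boundary is 0 departures (the second one, if [alpha = 1])
      starts at once, before any event;
    - the phase boundaries are those of the [n]-bidder auction whatever [S] is,
      so that when a late-departing winner is removed, the other bidders face
      the same phases as in the auction in which that winner never departs.
      With boundaries recomputed from [n - 1], the third phase of the simulation
      would start one departure early, the simulated price could fall below the
      winner's critical value, and overbidding would pay. *)
Definition alloc (R : realType) n (pi : 'S_n) (alpha pr : R)
    (Th : profile R n) (S : {set 'I_n}) : option 'I_n * \bar R * bool :=
  alloc_loop pi alpha pr Th finset.set0 finset.set0 0 (next_tau n alpha pr 0 0 +oo%E)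
    (events pi Th S).

Definition payment (R : realType) n (pi : 'S_n) (alpha pr : R)
    (Th : profile R n) (i : 'I_n) (tau : \bar R) : \bar R :=
  if (tau == pr%:E) && (third_start alpha n < dep_rank pi Th i)%N then
    let: (i', tau', active_winner') := alloc pi alpha pr Th [set~ i] in
    if ~~ active_winner' || (if i' is Some j then before pi i j else false)
    then tau' else tau
  else tau.

(** [fine] is harmless: a winner is only ever selected at a finite threshold,
    and the simulation in [payment] also ends with a finite one. *)
Definition three_phase (R : realType) n (pi : 'S_n) (alpha pr : R) :
  auction R n := fun Th =>
  let: (w, tau, _) := alloc pi alpha pr Th [set: 'I_n] in
  if w is Some i then
    Some (Outcome i (dep (Th i)) (fine (payment pi alpha pr Th i tau)))
  else None.

Definition W (R : realType) (n : nat) (alpha : R) : Prop :=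
  [/\ 0 <= alpha <= 1, alpha * n%:R \is a Num.nat &
      (1 - alpha) / 2 * n%:R \is a Num.nat].

(* Main.v *)
(** Fix a bidder [i] and run the auction on the other bidders. While [i] has not
    departed, her presence does not change the threshold, so she buys as soon as
    she is active and meets it, unless somebody else has claimed the item.  Her
    payment turns out to be the least threshold over all instants of her reported
    interval at which the item is still available to her ([payment_offered]);
    this quantity depends neither on her value nor on bidders arriving after her
    departure, and it can only increase when the interval shrinks, whence
    strategyproofness and the online property.

    For the revenue, let [r1], [r2] be the departure ranks of the bidders with
    the two highest values [v1 >= v2], and let the second and third phase start
    after [k1] and [k2] departures.  With a correct prediction the price is
    [v1] if [k1 < r1 <= k2].  For an arbitrary prediction [pr] the price is at
    least [v2] if [r2 <= k1 < r1] when [pr <= v1], and if [r2 <= k2 < r1] when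
    [pr > v1]; since [k1 + k2 = n], both events have probability
    [k1 * k2 / (n * (n - 1))]. *)
Require Import Defs.
From mathcomp Require Import all_boot all_order all_algebra all_fingroup.
From mathcomp Require Import boolp classical_sets reals ereal.
From mathcomp Require Import seq fintype finset ring.
Set Implicit Arguments.
Unset Strict Implicit.
Unset Printing Implicit Defensive.
Import Order.TTheory GRing.Theory Num.Theory.
Local Open Scope ring_scope.

(** * Event keys and instants *)

Section Auction.
Variables (R : realType) (n : nat) (pi : 'S_n) (alpha pr : R).

Local Notation key := (R *l (bool *l 'I_n))%type.
Local Notation k1 := (second_start alpha n).
Local Notation k2 := (third_start alpha n).
Implicit Types (Th : profile R n) (S : {set 'I_n}) (x y z : key).
Implicit Types (i j l : 'I_n) (e f : event n).

(** Instants are keys rather than reals: the lexicographic order separates simultaneous events, so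
    each step of the loop is an instant of its own. *)
Definition arr_key Th i : key := event_key pi Th (inl i).
Definition dep_key Th i : key := event_key pi Th (inr i).

Lemma event_key_inj Th : injective (event_key pi Th).
Proof. by case=> i [] j //= [_ /perm_inj->]. Qed.

Lemma arr_key_inj Th : injective (arr_key Th).
Proof. by move=> i j /event_key_inj[]. Qed.

Lemma dep_key_inj Th : injective (dep_key Th).
Proof. by move=> i j /event_key_inj[]. Qed.

Lemma arr_neq_dep_key Th i j : arr_key Th i != dep_key Th j.
Proof. by apply/eqP => /event_key_inj. Qed.

Lemma arr_lt_dep_key Th i :
  arr (Th i) <= dep (Th i) -> (arr_key Th i < dep_key Th i)%O.
Proof. by move=> le_ad; rewrite ltEprodlexi /= le_ad implybT. Qed.

Lemma le_dep_key Th Th' i :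
  dep (Th i) <= dep (Th' i) -> (dep_key Th i <= dep_key Th' i)%O.
Proof. by move=> le_dd; rewrite leEprodlexi /= le_dd lexx implybT. Qed.

Lemma le_arr_key Th Th' i :
  arr (Th i) <= arr (Th' i) -> (arr_key Th i <= arr_key Th' i)%O.
Proof. by move=> le_aa; rewrite leEprodlexi /= le_aa lexx implybT. Qed.

Lemma key_time x y : (x <= y)%O -> x.1 <= y.1.
Proof. by rewrite leEprodlexi => /andP[]. Qed.

(** * Departed sets, departure ranks and thresholds *)

Definition departed Th S x : {set 'I_n} :=
  [set j in S | (dep_key Th j <= x)%O]%SET.

Definition rank_in Th S j : nat := #|departed Th S (dep_key Th j)|.

(** Indexed by a number of departures because thresholds are frozen at the [k1]-th and [k2]-th
    departure; the base value 0 is the initial [vmax] of the loop. *)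
Definition vmax_first Th S (k : nat) : R :=
  \big[Num.max/0]_(j | (j \in S) && (rank_in Th S j <= k)%N) value (Th j).

(** Closed form of the threshold that [alloc_loop] maintains step by step. Testing [k2] first agrees
    with [next_tau] when the two boundaries coincide. *)
Definition tau_after Th S (c : nat) : \bar R :=
  if (k2 <= c)%N then (vmax_first Th S k2)%:E
  else if (k1 <= c)%N then (Num.max (vmax_first Th S k1) pr)%:E
  else +oo%E.

Definition tau_at Th S x : \bar R := tau_after Th S #|departed Th S x|.

(** [claims Th S x j]: right after the events up to [x], bidder [j] is active
    and meets the threshold. [alloc] stops at the first such [x]. *)
Definition claims Th S x j : bool :=
  [&& j \in S, (arr_key Th j <= x)%O, (x < dep_key Th j)%O &
      (tau_at Th S x <= (value (Th j))%:E)%E].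

Definition unsold_before Th S x : Prop :=
  forall y j, (y < x)%O -> ~~ claims Th S y j.

Lemma in_departed Th S x j :
  (j \in departed Th S x) = (j \in S) && (dep_key Th j <= x)%O.
Proof. by rewrite inE. Qed.

Lemma departed_sub Th S x y :
  (x <= y)%O -> departed Th S x \subset departed Th S y.
Proof.
move=> le_xy; apply/subsetP => j; rewrite !in_departed => /andP[-> /=] /le_trans.
exact.
Qed.

Lemma card_departed Th S x y :
  (x <= y)%O -> (#|departed Th S x| <= #|departed Th S y|)%N.
Proof. by move=> /departed_sub/subset_leq_card. Qed.

(** Departed sets form a chain, and before the departure of [j] they miss [j] herself, so they are
    strictly smaller. This translates between counts and instants. *)
Lemma leq_rank_in Th S x j : j \in S ->
  (rank_in Th S j <= #|departed Th S x|)%N = (dep_key Th j <= x)%O.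
Proof.
move=> jS; apply/idP/idP => [|le_x]; last exact: card_departed.
rewrite leNgt; apply: contraL => lt_x.
rewrite -ltnNge; apply/proper_card/properP; split; first exact/departed_sub/ltW.
by exists j; rewrite in_departed jS //= -ltNge.
Qed.

Lemma rank_in_gt0 Th S j : j \in S -> (0 < rank_in Th S j)%N.
Proof. by move=> jS; apply/card_gt0P; exists j; rewrite in_departed jS /=. Qed.

Lemma rank_in_inj Th S : {in S &, injective (rank_in Th S)}.
Proof.
move=> i j iS jS eq_ij; have [le_ij le_ji] : (dep_key Th i <= dep_key Th j)%O
  /\ (dep_key Th j <= dep_key Th i)%O.
  by rewrite -!(leq_rank_in _ _ iS) -!(leq_rank_in _ _ jS) -!/(rank_in _ _ _) eq_ij leqnn.
by apply: (@dep_key_inj Th); apply/le_anti/andP.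
Qed.

Lemma perm_rank_in Th S :
  perm_eq [seq rank_in Th S j | j <- enum S] (iota 1 #|S|).
Proof.
have uR : uniq [seq rank_in Th S j | j <- enum S].
  rewrite map_inj_in_uniq ?enum_uniq // => i j; rewrite !mem_enum.
  exact: rank_in_inj.
have sub : {subset [seq rank_in Th S j | j <- enum S] <= iota 1 #|S|}.
  move=> _ /mapP[j + ->]; rewrite mem_enum mem_iota add1n ltnS => jS.
  rewrite rank_in_gt0 //=; apply: subset_leq_card.
  by apply/subsetP => l; rewrite in_departed => /andP[].
apply: uniq_perm; rewrite ?iota_uniq //.
by case: (uniq_min_size uR sub) => //; rewrite size_iota size_map cardE.
Qed.

Lemma rank_in_surj Th S (k : nat) :
  (0 < k <= #|S|)%N -> exists2 j, j \in S & rank_in Th S j = k.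
Proof.
move=> k_S; have : k \in iota 1 #|S| by rewrite mem_iota add1n ltnS.
by rewrite -(perm_mem (perm_rank_in Th S)) => /mapP[j]; rewrite mem_enum => jS ->; exists j.
Qed.

Lemma card_rank_in_le Th S (k : nat) :
  (k <= #|S|)%N -> #|[set j in S | (rank_in Th S j <= k)%N]%SET| = k.
Proof.
move=> k_S; have cnt : count (fun c => c <= k)%N (iota 1 #|S|) = k.
  rewrite -(subnKC k_S) iotaD count_cat -[RHS]addn0; congr addn.
    rewrite -[RHS](size_iota 1); apply/eqP; rewrite -all_count; apply/allP => c.
    by rewrite mem_iota add1n ltnS => /andP[].
  apply/eqP; rewrite -leqn0 leqNgt -has_count -all_predC; apply/allP => c.
  by rewrite mem_iota add1n => /andP[kc _] /=; rewrite -ltnNge.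
rewrite -[RHS]cnt -(permP (perm_rank_in Th S)) count_map -sum1_count.
by rewrite big_enum_cond -sum1dep_card.
Qed.

Lemma vmax_first_ge0 Th S k : 0 <= vmax_first Th S k.
Proof. by rewrite /vmax_first; apply: bigmax_ge_id. Qed.

Lemma le_vmax_first Th S k k' :
  (k <= k')%N -> vmax_first Th S k <= vmax_first Th S k'.
Proof.
move=> le_kk'; apply: sub_bigmax => j /andP[-> /=] /leq_trans; exact.
Qed.

Lemma value_le_vmax Th S k j :
  j \in S -> (rank_in Th S j <= k)%N -> value (Th j) <= vmax_first Th S k.
Proof. by move=> jS le_k; apply: le_bigmax_cond; rewrite jS. Qed.

Lemma vmax_first_le Th S k (u : R) : 0 <= u ->
  (forall j, j \in S -> (rank_in Th S j <= k)%N -> value (Th j) <= u) ->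
  vmax_first Th S k <= u.
Proof. by move=> u0 le_u; apply: bigmax_le => // j /andP[jS le_k]; apply: le_u. Qed.

(** A threshold reads only the values and departure keys of bidders already departed. The
    irrelevance of a bidder still present and that of later arrivals are both instances. *)
Lemma tau_local Th Th' S S' x :
  (forall j, j \in departed Th S x \/ j \in departed Th' S' x ->
     [/\ j \in S, j \in S' & Th j = Th' j]) ->
  tau_at Th S x = tau_at Th' S' x.
Proof.
move=> loc.
have eqD y : (y <= x)%O -> departed Th S y = departed Th' S' y.
  move=> le_yx; apply/setP => j; apply/idP/idP => jD.
    have [|jS jS' eq_j] := loc j; first by left; apply: (subsetP _) jD; apply: departed_sub.
    by move: jD; rewrite !in_departed jS jS' /dep_key /= eq_j.
  have [|jS jS' eq_j] := loc j; first by right; apply: (subsetP _) jD; apply: departed_sub.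
  by move: jD; rewrite !in_departed jS jS' /dep_key /= eq_j.
have eq_dk j : j \in departed Th S x -> dep_key Th j = dep_key Th' j.
  by move=> jD; rewrite /dep_key /=; have [|_ _ ->] := loc j; first left.
(* Only ranks up to the current count are settled at [x]; a boundary satisfies this bound whenever
   its branch of [tau_after] is taken. *)
have eqV k : (k <= #|departed Th S x|)%N -> vmax_first Th S k = vmax_first Th' S' k.
  move=> le_k; rewrite /vmax_first.
  have P1 j : (j \in S) && (rank_in Th S j <= k)%N =
              (j \in S') && (rank_in Th' S' j <= k)%N.
    apply/andP/andP => -[jS le_j].
      have jx : (dep_key Th j <= x)%O by rewrite -(leq_rank_in _ _ jS) (leq_trans le_j).
      have jD : j \in departed Th S x by rewrite in_departed jS.
      have [|_ jS' eq_j] := loc j; first by left.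
      by split=> //; rewrite /rank_in -eq_dk // -eqD.
    rewrite eqD // in le_k.
    have jx : (dep_key Th' j <= x)%O by rewrite -(leq_rank_in _ _ jS) (leq_trans le_j).
    have jD' : j \in departed Th' S' x by rewrite in_departed jS.
    have jD : j \in departed Th S x by rewrite eqD.
    have [|jS' _ eq_j] := loc j; first by left.
    by split=> //; rewrite /rank_in eq_dk // eqD.
  rewrite (eq_bigl _ _ P1); apply: eq_bigr => j; rewrite -P1 => /andP[jS le_j].
  have jx : (dep_key Th j <= x)%O by rewrite -(leq_rank_in _ _ jS) (leq_trans le_j).
  by have [|_ _ ->] := loc j; first by left; rewrite in_departed jS.
rewrite /tau_at -eqD // /tau_after; case: leqP => [le2|_]; first by rewrite eqV.
by case: leqP => // le1; rewrite eqV.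
Qed.

Lemma tau_at_ge0 Th S x : (0 <= tau_at Th S x)%E.
Proof.
rewrite /tau_at /tau_after; case: ifP => _; first by rewrite lee_fin vmax_first_ge0.
by case: ifP => _; rewrite ?leey // lee_fin le_max vmax_first_ge0.
Qed.

Lemma pi_firstP (B : {set 'I_n}) :
  if pi_first pi B is Some i then i \in B /\ forall j, j \in B -> (pi i <= pi j)%N
  else forall j, j \notin B.
Proof.
rewrite /pi_first; case: pickP => [i /andP[iB /forall_inP le_i] //|none j].
apply/negP => jB; case: (arg_minnP (fun l => pi l : nat) jB) => i iB le_i.
by have /negbT/negP[] := none i; apply/andP; split=> //; apply/forall_inP.
Qed.


(** * Correctness of the allocation loop *)

Definition bidder e : 'I_n := match e with inl i | inr i => i end.
Definition is_departure e : bool := if e is inr _ then true else false.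

Lemma mem_events Th S e : (e \in events pi Th S) = (bidder e \in S).
Proof.
rewrite mem_sort mem_cat; case: e => i /=.
  rewrite mem_image //; last by move=> ? ? [].
  by rewrite orbC; case: imageP => // -[].
rewrite orbC mem_image //; last by move=> ? ? [].
by rewrite orbC; case: imageP => // -[].
Qed.

Lemma events_split Th S es1 e es2 f :
  events pi Th S = es1 ++ e :: es2 -> f \in events pi Th S ->
  (f \in es1) = (event_key pi Th f < event_key pi Th e)%O.
Proof.
move=> def_es; have tr : transitive (event_le pi Th) by move=> ? ? ?; apply: le_trans.
have tot : total (event_le pi Th) by move=> ? ?; apply: le_total.
have uniq_es : uniq (events pi Th S).
  rewrite sort_uniq cat_uniq.
  rewrite !map_inj_uniq ?enum_uniq //= ?andbT; try by move=> ? ? [].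
  by apply/hasPn => _ /mapP[i _ ->]; apply/mapP => -[].
have := sort_sorted tot ([seq inl i | i in S] ++ [seq inr i | i in S]).
rewrite -/(events pi Th S) (sorted_pairwise tr) def_es pairwise_cat /=.
case/and3P => /allrelP le12 _ /andP[/allP le2 _].
move: uniq_es; rewrite def_es cat_uniq /= negb_or => /and3P[_ /andP[e1 _] _].
rewrite mem_cat inE => f_es; apply/idP/idP => [f1|].
  have le_fe := le12 _ _ f1 (mem_head e es2).
  rewrite lt_neqAle [(_ <= _)%O]le_fe andbT; apply: contraNneq e1.
  by move/event_key_inj <-.
case/or3P: f_es => // [/eqP->|/le2]; first by rewrite ltxx.
by move=> ?; rewrite ltNge => /negP[].
Qed.

(** Active set and threshold change only at events, so a claim at [x] already stands at the last
    event up to [x]. *)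
Lemma claims_at_event Th S x j : claims Th S x j ->
  exists e, [/\ e \in events pi Th S, (event_key pi Th e <= x)%O &
               claims Th S (event_key pi Th e) j].
Proof.
case/and4P => jS arr_j dep_j tau_j.
have Pj : (inl j \in events pi Th S) && (event_key pi Th (inl j) <= x)%O.
  by rewrite mem_events jS.
case: (@arg_maxP _ _ _ (inl j)
  (fun e => (e \in events pi Th S) && (event_key pi Th e <= x)%O)
  (event_key pi Th) Pj) => e /andP[eS le_ex] max_e.
exists e; split=> //; apply/and4P; split=> //; first exact: max_e.
  exact: le_lt_trans dep_j.
rewrite /tau_at; suff -> : departed Th S (event_key pi Th e) = departed Th S x by [].
apply/eqP; rewrite eqEsubset departed_sub //=; apply/subsetP => l.
rewrite !in_departed => /andP[lS le_l]; rewrite lS /=; apply: (max_e (inr l)).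
by rewrite mem_events lS.
Qed.

(** Loop-free description of [alloc]; later arguments use it instead of the recursion. *)
Variant alloc_spec Th S : option 'I_n * \bar R * bool -> Prop :=
  | AllocSold e i of e \in events pi Th S & claims Th S (event_key pi Th e) i
      & unsold_before Th S (event_key pi Th e)
      & (forall j, claims Th S (event_key pi Th e) j -> (pi i <= pi j)%N) :
      alloc_spec Th S (Some i, tau_at Th S (event_key pi Th e), is_departure e)
  | AllocUnsold of (forall x j, ~~ claims Th S x j) :
      alloc_spec Th S (None, tau_after Th S #|S|, false).

Hypothesis le_k12 : (k1 <= k2)%N.

Lemma next_tau_after Th S (c : nat) : (0 < c)%N ->
  next_tau n alpha pr c (vmax_first Th S c) (tau_after Th S c.-1) = tau_after Th S c.
Proof.
move=> c0; rewrite /next_tau /tau_after.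
have step (k : nat) : (k <= c)%N = (c == k) || (k <= c.-1)%N.
  by rewrite -[in LHS](prednK c0) leq_eqVlt ltnS prednK // eq_sym.
rewrite !step; case: (c =P k2) => [->|_] //=; case: (c =P k1) => [eq1|_] //=.
have lt2 : (c.-1 < k2)%N by rewrite prednK // eq1.
by rewrite [(k2 <= _)%N]leqNgt lt2 eq1.
Qed.


(** Loop invariant: [es1] has been processed without a claim, and every active bidder misses the
    current threshold. *)
Lemma alloc_loopP Th S es1 es2 A L : valid_profile Th ->
  events pi Th S = es1 ++ es2 ->
  L = [set j in S | inr j \in es1] ->
  A = [set j in S | (inl j \in es1) && (inr j \notin es1)] ->
  {in A, forall j, ~~ (tau_after Th S #|L| <= (value (Th j))%:E)%E} ->
  {in es1, forall e j, ~~ claims Th S (event_key pi Th e) j} ->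
  alloc_spec Th S
    (alloc_loop pi alpha pr Th A L (vmax_first Th S #|L|) (tau_after Th S #|L|) es2).
Proof.
move=> valTh; elim: es2 es1 A L => [|e es2 IH] es1 A L def_es.
  rewrite cats0 in def_es => defL _ _ no_claim /=.
  have -> : #|L| = #|S|.
    by rewrite defL; apply: eq_card => j; rewrite inE -def_es mem_events andbb.
  apply: AllocUnsold => x j; apply/negP => /claims_at_event[e [eS _]].
  by apply/negP/no_claim; rewrite -def_es.
move=> defL defA noA no_claim.
have eS : bidder e \in S by rewrite -(mem_events Th) def_es mem_cat mem_head orbT.
have mem1 := events_split def_es.
have mem_arr j : j \in S -> (inl j \in es1) = (arr_key Th j < event_key pi Th e)%O.
  by move=> jS; rewrite mem1 ?mem_events.
have mem_dep j : j \in S -> (inr j \in es1) = (dep_key Th j < event_key pi Th e)%O.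
  by move=> jS; rewrite mem1 ?mem_events.
have first_e : unsold_before Th S (event_key pi Th e).
  move=> y j lt_y; apply/negP => /claims_at_event[f [fS le_fy]].
  by apply/negP/no_claim; rewrite mem1 ?(le_lt_trans le_fy).
have def_es' : events pi Th S = rcons es1 e ++ es2 by rewrite def_es cat_rcons.
case: e eS def_es def_es' mem1 mem_arr mem_dep first_e => i /= iS def_es def_es'
  mem1 mem_arr mem_dep first_e.
  have dep_i : departed Th S (arr_key Th i) = L.
    apply/setP => j; rewrite defL in_departed inE; case: (boolP (j \in S)) => //= jS.
    by rewrite mem_dep // le_eqVlt eq_sym (negPf (arr_neq_dep_key _ _ _)).
  have tau_i : tau_at Th S (arr_key Th i) = tau_after Th S #|L|.
    by rewrite /tau_at dep_i.
  (* An arrival leaves the threshold unchanged, and the bidders already active are below it, so only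
     the newcomer can claim. *)
  have only_i j : claims Th S (arr_key Th i) j -> j = i.
    case/and4P => jS arr_j dep_j; rewrite tau_i => tau_j; apply/eqP.
    apply: contraTT tau_j => ne_ji; apply: noA.
    rewrite defA inE jS mem_arr // mem_dep // -leNgt (ltW dep_j) andbT lt_neqAle.
    by rewrite [(_ <= _)%O]arr_j andbT (inj_eq (@arr_key_inj Th)).
  case: ifP => [tau_le|/negbT tau_gt].
    rewrite -tau_i; apply: (@AllocSold _ _ (inl i)) => //.
    + by rewrite mem_events.
    + by rewrite /claims iS lexx [(_ < _)%O]arr_lt_dep_key ?tau_i //=; case: (valTh i).
    + by move=> j /only_i ->.
  apply: (IH (rcons es1 (inl i))) => //.
  - by rewrite defL; apply/setP => j; rewrite !inE mem_rcons inE.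
  - apply/setP => j; rewrite defA !inE !mem_rcons !inE /=.
    have -> : (inl j == inl i :> event n) = (j == i) by [].
    case: (eqVneq j i) => [->|] //=; rewrite iS /= mem_dep //.
    by rewrite -leNgt [RHS]ltW // arr_lt_dep_key //; case: (valTh i).
  - by move=> j; rewrite !inE => /predU1P[->|/noA].
  - move=> f; rewrite mem_rcons inE => /predU1P[-> j|/no_claim //].
    by apply: contra tau_gt => cl; rewrite -tau_i; case/and4P: (cl) => _ _ _; rewrite (only_i _ cl).
have dep_i : departed Th S (dep_key Th i) = i |: L.
  apply/setP => j; rewrite defL in_departed !inE; case: (eqVneq j i) => [->|ne_ji] /=.
    by rewrite iS lexx.
  case: (boolP (j \in S)) => //= jS.
  by rewrite mem_dep // le_eqVlt (inj_eq (@dep_key_inj Th)) (negPf ne_ji).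
have notL : i \notin L by rewrite defL inE iS mem_dep //= ltxx.
have -> : Num.max (vmax_first Th S #|L|) (value (Th i)) = vmax_first Th S #|i |: L|.
  apply/le_anti/andP; split.
    rewrite ge_max le_vmax_first ?subset_leq_card ?subsetUr //=.
    by apply: value_le_vmax => //; rewrite /rank_in dep_i.
  apply: vmax_first_le => [|j jS]; first by rewrite le_max vmax_first_ge0.
  rewrite -dep_i leq_rank_in // => le_ji; rewrite le_max.
  have : j \in i |: L by rewrite -dep_i in_departed jS.
  case/setU1P => [->|jL]; first by rewrite lexx orbT.
  rewrite value_le_vmax //; apply/subset_leq_card/subsetP => l.
  rewrite in_departed => /andP[lS le_lj].
  move: jL; rewrite defL !inE lS jS /= !mem_dep //; exact: le_lt_trans.
have -> : next_tau n alpha pr #|i |: L| (vmax_first Th S #|i |: L|) (tau_after Th S #|L|)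
          = tau_after Th S #|i |: L|.
  have -> : #|i |: L| = #|L|.+1 by rewrite cardsU1 notL.
  exact: (@next_tau_after Th S #|L|.+1).
have tau_i : tau_at Th S (dep_key Th i) = tau_after Th S #|i |: L|.
  by rewrite /tau_at dep_i.
have mem_B j : (j \in [set l in A :\ i | (tau_after Th S #|i |: L| <= (value (Th l))%:E)%E])
    = claims Th S (dep_key Th i) j.
  rewrite defA !inE /claims tau_i; case: (boolP (j \in S)) => [jS|]; last by rewrite andbF.
  rewrite mem_arr // mem_dep // !andTb; case: (eqVneq j i) => [->|ne_ji] /=.
    by rewrite ltxx andbF.
  rewrite -leNgt le_eqVlt -/(dep_key Th i) (inj_eq (@dep_key_inj Th)) eq_sym.
  rewrite (negPf ne_ji) orFb -andbA; by congr [&& _, _ & _].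
have := pi_firstP [set l in A :\ i | (tau_after Th S #|i |: L| <= (value (Th l))%:E)%E].
case: (pi_first pi _) => [j [jB min_j]|noB].
  rewrite -tau_i; apply: (@AllocSold _ _ (inr i)) => //; first by rewrite mem_events.
    by rewrite -mem_B.
  by move=> l; rewrite -mem_B; apply: min_j.
apply: (IH (rcons es1 (inr i))) => //.
- apply/setP => j; rewrite defL !inE mem_rcons inE.
  have -> : (inr j == inr i :> event n) = (j == i) by [].
  by case: (eqVneq j i) => [->|] //=; rewrite iS.
- apply/setP => j; rewrite defA !inE !mem_rcons !inE negb_or /=.
  have -> : (inr j == inr i :> event n) = (j == i) by [].
  by case: (eqVneq j i) => [->|] //=; rewrite !andbF.
- by move=> j jA; have := noB j; rewrite inE jA.
- move=> f; rewrite mem_rcons inE => /predU1P[-> j|/no_claim //].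
  by rewrite -mem_B.
Qed.

Lemma allocP Th S : valid_profile Th -> alloc_spec Th S (alloc pi alpha pr Th S).
Proof.
move=> valTh; have vmax0 : vmax_first Th S 0 = 0.
  rewrite /vmax_first big_pred0 // => j; case: (boolP (j \in S)) => //= jS.
  by rewrite leqNgt rank_in_gt0.
(* The initial thresholds agree: a boundary at 0 departures takes an empty maximum, which is 0. *)
have -> : alloc pi alpha pr Th S = alloc_loop pi alpha pr Th set0 set0
    (vmax_first Th S #|@set0 'I_n|) (tau_after Th S #|@set0 'I_n|) (events pi Th S).
  rewrite cards0 vmax0 /alloc /next_tau /tau_after !leqn0 ![0%N == _]eq_sym.
  by case: eqP => [->|]; rewrite ?vmax0 //; case: eqP => [->|]; rewrite ?vmax0.
apply: (@alloc_loopP _ _ [::]) => //.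
- by apply/setP => j; rewrite !inE andbF.
- by apply/setP => j; rewrite !inE andbF.
- by move=> j; rewrite inE.
Qed.

(** * Offers to a fixed bidder and the payment rule *)

Lemma departed_others Th i x : (x < dep_key Th i)%O ->
  departed Th [set: 'I_n] x = departed Th [set~ i] x.
Proof.
move=> lt_x; apply/setP => j; rewrite !in_departed !inE /=.
by case: (eqVneq j i) => [->|] //=; rewrite leNgt lt_x.
Qed.

Lemma tau_others Th i x : (x < dep_key Th i)%O ->
  tau_at Th [set: 'I_n] x = tau_at Th [set~ i] x.
Proof.
move=> lt_x; apply: tau_local => j; rewrite (departed_others lt_x) => jD.
have : j \in departed Th [set~ i] x by case: jD.
by rewrite in_departed => /andP[-> _]; rewrite inE.
Qed.

Lemma claims_others Th i x j : (x < dep_key Th i)%O ->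
  claims Th [set~ i] x j = (j != i) && claims Th [set: 'I_n] x j.
Proof. by move=> lt_x; rewrite /claims (tau_others lt_x) !inE. Qed.

(** The instant is the later of her own arrival and the departure just preceding hers; for the first
    bidder to depart, her arrival. *)
Lemma active_before_departure Th S j : valid_profile Th -> j \in S ->
  exists x, [/\ (arr_key Th j <= x)%O, (x < dep_key Th j)%O &
                #|departed Th S x| = (rank_in Th S j).-1].
Proof.
move=> valTh jS; have lt_ad : (arr_key Th j < dep_key Th j)%O.
  by apply: arr_lt_dep_key; case: (valTh j).
have lt_rank x : (x < dep_key Th j)%O -> (#|departed Th S x| <= (rank_in Th S j).-1)%N.
  by rewrite -ltnS prednK ?rank_in_gt0 // ltNge -(leq_rank_in _ _ jS) -ltnNge.
have [r1|r2] := posnP (rank_in Th S j).-1.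
  exists (arr_key Th j); split=> //; apply/eqP; rewrite r1 -leqn0 -r1; exact: lt_rank.
have [|l lS rank_l] := @rank_in_surj Th S (rank_in Th S j).-1.
  rewrite r2 /=; apply: leq_trans (leq_pred _) _; apply/subset_leq_card/subsetP => l.
  by rewrite in_departed => /andP[].
have lt_lj : (dep_key Th l < dep_key Th j)%O.
  by rewrite ltNge -(leq_rank_in _ _ jS) -/(rank_in Th S l) rank_l -ltnNge prednK ?rank_in_gt0.
exists (Order.max (arr_key Th j) (dep_key Th l)).
rewrite le_max lexx gt_max lt_ad lt_lj; split=> //; apply/eqP; rewrite eqn_leq lt_rank.
  by rewrite -rank_l leq_rank_in // le_max lexx orbT.
by rewrite gt_max lt_ad.
Qed.

(** [x] is an instant at which bidder [i] buys if she meets the threshold: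
    she is active and no other bidder takes the item first. *)
Definition offered Th i x : Prop :=
  [/\ (arr_key Th i <= x < dep_key Th i)%O, unsold_before Th [set~ i] x &
      forall j, claims Th [set~ i] x j -> before pi i j].

(** Her claim at [x] forces a sale by then. Another winner would also claim in the auction without
    [i], either before [x] or with priority at [x], and an offer excludes both. *)
Lemma offered_alloc Th i x : valid_profile Th -> offered Th i x ->
  (tau_at Th [set~ i] x <= (value (Th i))%:E)%E ->
  exists tau b, alloc pi alpha pr Th [set: 'I_n] = (Some i, tau, b).
Proof.
move=> valTh [/andP[arr_i dep_i] uns first_i] tau_le.
have cl_i : claims Th [set: 'I_n] x i.
  by rewrite /claims inE arr_i dep_i (tau_others dep_i).
case: (allocP [set: 'I_n] valTh) => [e w eT cl_w uns_e min_w|no_claim]; last first.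
  by case/negP: (no_claim x i).
have [->|ne_wi] := eqVneq w i; first by eexists; eexists.
have le_ex : (event_key pi Th e <= x)%O.
  by rewrite leNgt; apply/negP => /(uns_e _ i)/negP[].
have cl_w' : claims Th [set~ i] (event_key pi Th e) w.
  by rewrite claims_others ?ne_wi // (le_lt_trans le_ex).
move: le_ex; rewrite le_eqVlt => /predU1P[eq_x|/(uns _ w)/negP[] //].
rewrite -eq_x in cl_i first_i; have := first_i w cl_w'.
by rewrite /before ltnNge min_w.
Qed.

(** The winning event is the witness: no claim precedes it, so earlier offers had thresholds above
    her value. *)
Lemma alloc_offered Th i tau b : valid_profile Th ->
  alloc pi alpha pr Th [set: 'I_n] = (Some i, tau, b) ->
  exists x, [/\ offered Th i x, tau = tau_at Th [set~ i] x,
    (tau <= (value (Th i))%:E)%E &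
    forall y, offered Th i y -> (y < x)%O ->
      ((value (Th i))%:E < tau_at Th [set~ i] y)%E].
Proof.
move=> valTh; case: (allocP [set: 'I_n] valTh) => // e w eT cl_w uns_e min_w [<- <- _].
case/and4P: (cl_w) => _ arr_w dep_w tau_w; exists (event_key pi Th e).
rewrite (tau_others dep_w) in tau_w *; split=> //.
  split=> [|y j lt_y|j]; first by rewrite arr_w.
    by rewrite claims_others ?(lt_trans lt_y) // negb_and uns_e ?orbT.
  rewrite claims_others // => /andP[ne_jw /min_w le_wj].
  by rewrite /before ltn_neqAle le_wj andbT (inj_eq val_inj) (inj_eq perm_inj) eq_sym.
move=> y [/andP[arr_y dep_y] _ _] lt_y; rewrite ltNge; apply/negP => tau_y.
by case/negP: (uns_e _ w lt_y); rewrite /claims inE arr_y dep_y (tau_others dep_y).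
Qed.

(** A bidder departing in the second phase while the item is unsold has just faced its threshold and
    is below it. Hence an unsold item does not become dearer in the third phase. *)
Lemma vmax_first_le_tau Th S z k : valid_profile Th ->
  unsold_before Th S z -> (k <= k2)%N -> (k <= #|departed Th S z|)%N ->
  vmax_first Th S k <= Num.max (vmax_first Th S k1) pr.
Proof.
move=> valTh uns le_k k_z; apply: vmax_first_le => [|j jS le_jk].
  by rewrite le_max vmax_first_ge0.
have [le1|gt1] := leqP (rank_in Th S j) k1; first by rewrite le_max value_le_vmax.
have [x [arr_x dep_x card_x]] := active_before_departure valTh jS.
have lt_xz : (x < z)%O.
  by apply: lt_le_trans dep_x _; rewrite -(leq_rank_in _ _ jS) (leq_trans le_jk).
have := uns x j lt_xz; rewrite /claims jS arr_x dep_x /= /tau_at card_x /tau_after.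
have r0 := rank_in_gt0 Th jS.
rewrite [(k2 <= _)%N]leqNgt prednK // (leq_trans le_jk le_k) /=.
have -> : (k1 <= (rank_in Th S j).-1)%N by rewrite -ltnS prednK.
by rewrite -ltNge lte_fin => /ltW.
Qed.

Lemma tau_phase3 Th S x :
  (k2 <= #|departed Th S x|)%N -> tau_at Th S x = (vmax_first Th S k2)%:E.
Proof. by rewrite /tau_at /tau_after => ->. Qed.

Lemma tau_phase2 Th S x :
  (k1 <= #|departed Th S x|)%N -> (#|departed Th S x| < k2)%N ->
  tau_at Th S x = (Num.max (vmax_first Th S k1) pr)%:E.
Proof. by move=> le1 lt2; rewrite /tau_at /tau_after leqNgt lt2 le1. Qed.

Lemma tau_finite Th S x (u : R) :
  (tau_at Th S x <= u%:E)%E -> (k1 <= #|departed Th S x|)%N.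
Proof.
rewrite /tau_at /tau_after; case: leqP => [le2 _|_]; first exact: leq_trans le2.
by case: leqP => // _; rewrite leye_eq.
Qed.

Lemma dep_rank_in Th i : dep_rank pi Th i = rank_in Th [set: 'I_n] i.
Proof. by apply: eq_card => j; rewrite !inE. Qed.

Lemma departed_at_own Th i :
  departed Th [set: 'I_n] (dep_key Th i) = i |: departed Th [set~ i] (dep_key Th i).
Proof. by apply/setP => j; rewrite !inE; case: (eqVneq j i) => [->|]; rewrite /= ?lexx. Qed.

(** After the winning instant the threshold can fall only at the start of the third phase. The
    simulation without [i] decides whether the item would still be offered to her then. *)
Lemma payment_offered Th i tau b : valid_profile Th ->
  alloc pi alpha pr Th [set: 'I_n] = (Some i, tau, b) ->
  exists x, [/\ offered Th i x,
    payment pi alpha pr Th i tau = tau_at Th [set~ i] x,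
    (tau_at Th [set~ i] x <= (value (Th i))%:E)%E &
    forall y, offered Th i y -> (tau_at Th [set~ i] x <= tau_at Th [set~ i] y)%E].
Proof.
move=> valTh /(alloc_offered valTh)[x [off tau_x tau_v below]].
have [/andP[arr_x dep_x] uns_x first_x] := off; rewrite {}tau_x in tau_v *.
set O := [set~ i] in uns_x first_x tau_v below *.
have k1_x := tau_finite tau_v.
(* Before [x], every offered threshold exceeded her value, so only instants from [x] on can beat
   it. *)
have min_x : (forall y, (x <= y)%O -> offered Th i y -> (tau_at Th O x <= tau_at Th O y)%E) ->
    forall y, offered Th i y -> (tau_at Th O x <= tau_at Th O y)%E.
  move=> above y off_y; case: (leP x y) => [/above -> //|lt_yx].
  exact: le_trans tau_v (ltW (below y off_y lt_yx)).
(* In the third phase the threshold is final, and every branch of the payment returns it. *)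
have [x3|x2] := leqP k2 #|departed Th O x|.
  have tau3 y : (x <= y)%O -> tau_at Th O y = (vmax_first Th O k2)%:E.
    by move=> le_xy; apply/tau_phase3/(leq_trans x3)/card_departed.
  exists x; split=> //; last by apply: min_x => y le_xy _; rewrite !tau3.
  rewrite /payment; case: ifP => // _; rewrite tau3 //.
  case: (allocP O valTh) => [e w eO cl_w uns_e min_w|no_claim].
    rewrite tau3; first by case: ifP.
    by rewrite leNgt; apply/negP => /(uns_x _ w)/negP[].
  have k2_O : (k2 <= #|O|)%N.
    by apply: leq_trans x3 _; apply/subset_leq_card/subsetP => j; rewrite inE => /andP[].
  by rewrite /= /tau_after k2_O.
have def_tau := tau_phase2 k1_x x2.
(* Without a simulation, either she leaves before the third phase, or the second-phase threshold is
   a departed value above [pr], which the third-phase maximum also covers. *)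
rewrite /payment; case: ifP => [/andP[/eqP tau_pr late]|early]; last first.
  exists x; split=> //; apply: min_x => y le_xy [/andP[_ dep_y] _ _].
  have [y3|y2] := leqP k2 #|departed Th O y|; last first.
    by rewrite def_tau (tau_phase2 _ y2) // (leq_trans k1_x) ?card_departed.
  have late : (k2 < dep_rank pi Th i)%N.
    rewrite dep_rank_in (leq_ltn_trans y3) // -(departed_others dep_y).
    by rewrite ltnNge leq_rank_in ?inE // -ltNge.
  move: early; rewrite late andbT def_tau tau_phase3 // lee_fin ge_max le_vmax_first //=.
  move/eqP => ne_pr; have [le_pr|/ltW lt_pr] := leP (vmax_first Th O k1) pr.
    by case: ne_pr; rewrite (max_idPr le_pr).
  exact: le_trans lt_pr (le_vmax_first _ _ le_k12).
have max_pr : Num.max (vmax_first Th O k1) pr = pr by move: tau_pr; rewrite def_tau => -[].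
have k2_O : (k2 <= #|departed Th O (dep_key Th i)|)%N.
  move: late; rewrite dep_rank_in /rank_in departed_at_own cardsU1.
  by rewrite in_departed !inE eqxx.
have k2_0 : (0 < k2)%N by apply: leq_ltn_trans x2.
have [|l lO rank_l] := @rank_in_surj Th O k2.
  rewrite k2_0 (leq_trans k2_O) //; apply/subset_leq_card/subsetP => j.
  by rewrite in_departed => /andP[].
have phase3 y : (k2 <= #|departed Th O y|)%N = (dep_key Th l <= y)%O.
  by rewrite -rank_l leq_rank_in.
(* [z] is the start of the third phase when [i] is absent. *)
set z := dep_key Th l in phase3.
have lt_xz : (x < z)%O by rewrite ltNge -phase3 -ltnNge.
have lt_zi : (z < dep_key Th i)%O.
  rewrite lt_neqAle (inj_eq (@dep_key_inj Th)) -phase3 k2_O andbT.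
  by move: lO; rewrite !inE.
have tau2 y : (x <= y)%O -> (y < z)%O -> tau_at Th O y = tau_at Th O x.
  move=> le_xy lt_yz; rewrite tau_phase2 ?def_tau //.
    exact: leq_trans (card_departed _ _ le_xy).
  by rewrite ltnNge phase3 -ltNge.
have tau3 y : (z <= y)%O -> tau_at Th O y = (vmax_first Th O k2)%:E.
  by rewrite -phase3; apply: tau_phase3.
have drop : unsold_before Th O z -> (vmax_first Th O k2 <= pr).
  move=> uns_z; rewrite -max_pr; apply: vmax_first_le_tau uns_z _ _ => //.
  by rewrite phase3.
(* If the item is offered to [i] at [z], the minimum is there: the threshold is constant afterwards
   and, by [drop], no smaller between [x] and [z]. *)
have at_z : unsold_before Th O z -> (forall j, claims Th O z j -> before pi i j) ->
  exists t, [/\ offered Th i t, (vmax_first Th O k2)%:E = tau_at Th O t,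
    (tau_at Th O t <= (value (Th i))%:E)%E &
    forall y, offered Th i y -> (tau_at Th O t <= tau_at Th O y)%E].
  move=> uns_z first_z; exists z; rewrite tau3 //; split=> //.
  - by split=> //; rewrite (le_trans arr_x (ltW lt_xz)).
  - by apply: le_trans tau_v; rewrite tau_pr lee_fin drop.
  - move=> y off_y; have [le_zy|lt_yz] := leP z y; first by rewrite tau3.
    apply: (@le_trans _ _ pr%:E); first by rewrite lee_fin drop.
    rewrite -tau_pr; have [le_xy|lt_yx] := leP x y; first by rewrite tau2.
    exact: le_trans tau_v (ltW (below y off_y lt_yx)).
(* If somebody else takes the item before [z], or at [z] with priority over [i], no offer from [z]
   on remains, and [x] is minimal. *)
have at_x (e : event n) w : (x <= event_key pi Th e)%O -> claims Th O (event_key pi Th e) w ->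
  (event_key pi Th e < z)%O \/ event_key pi Th e = z /\ ~~ before pi i w ->
  exists t, [/\ offered Th i t, tau_at Th O x = tau_at Th O t,
    (tau_at Th O t <= (value (Th i))%:E)%E &
    forall y, offered Th i y -> (tau_at Th O t <= tau_at Th O y)%E].
  move=> le_xe cl_w e_z; exists x; split=> //; apply: min_x => y le_xy [_ uns_y first_y].
  rewrite tau2 //; have le_ye : (y <= event_key pi Th e)%O.
    by rewrite leNgt; apply/negP => /(uns_y _ w)/negP[].
  case: e_z => [|[eq_ez not_before]]; first exact: le_lt_trans.
  rewrite -eq_ez lt_neqAle le_ye andbT; apply: contraNneq not_before => eq_y.
  by apply: first_y; rewrite eq_y.
(* If the simulation ends unsold or sells after [z], [at_z] applies; if it sells before [z], [at_x]
   does; at [z] itself [pi] decides. *)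
case: (allocP O valTh) => [e w eO cl_w uns_e min_w|no_claim]; last first.
  rewrite /= /tau_after [(k2 <= #|O|)%N](leq_trans k2_O).
    by apply: at_z => [y j _|j cl_j] //; case/negP: (no_claim z j).
  by apply/subset_leq_card/subsetP => j; rewrite in_departed => /andP[].
have le_xe : (x <= event_key pi Th e)%O.
  by rewrite leNgt; apply/negP => /(uns_x _ w)/negP[].
have [le_ze|lt_ez] := leP z (event_key pi Th e); last first.
  (* Both branches of the payment rule agree here, the simulated threshold being still that of the
     second phase. *)
  by rewrite tau2 // if_same; apply: (at_x e w) => //; left.
have uns_z : unsold_before Th O z by move=> y j lt_yz; apply/uns_e/(lt_le_trans lt_yz).
rewrite tau3 //.
case: e eO cl_w uns_e min_w le_xe le_ze => a aO cl_w uns_e min_w le_xe le_ze /=.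
  have lt_ze : (z < event_key pi Th (inl a))%O.
    by rewrite lt_neqAle [(_ <= _)%O]le_ze andbT eq_sym (arr_neq_dep_key Th).
  by apply: at_z => // j cl_j; case/negP: (uns_e z j lt_ze).
(* The threshold is constant after [z], so a bidder claiming the item at a
   departure after [z] would have claimed it before. *)
have eq_ez : event_key pi Th (inr a) = z.
  apply/le_anti; rewrite le_ze andbT leNgt; apply/negP => lt_ze.
  have [wO arr_w dep_w tau_w] := and4P cl_w.
  have lt_y : (Order.max z (arr_key Th w) < event_key pi Th (inr a))%O.
    by rewrite gt_max lt_ze lt_neqAle [(_ <= _)%O]arr_w andbT (arr_neq_dep_key Th).
  case/negP: (uns_e _ w lt_y); rewrite /claims wO le_max lexx orbT (lt_trans lt_y) //=.
  by rewrite tau3 ?le_max ?lexx // -(tau3 (event_key pi Th (inr a))).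
case: ifP => [bef_iw|/negbT not_before]; last by apply: at_x cl_w _ => //; right.
apply: at_z => // j; rewrite -eq_ez => /min_w; exact: leq_trans.
Qed.

(** * Strategyproofness and the online property *)

Lemma three_phase_sale Th o : valid_profile Th ->
  three_phase pi alpha pr Th = Some o ->
  [/\ alloc_time o = dep (Th (winner o)), price o <= value (Th (winner o)) &
    exists x, [/\ offered Th (winner o) x, tau_at Th [set~ winner o] x = (price o)%:E &
      forall y, offered Th (winner o) y ->
        ((price o)%:E <= tau_at Th [set~ winner o] y)%E]].
Proof.
move=> valTh; rewrite /three_phase.
case def_a: (alloc _ _ _ _ _) => [[[i|//] tau] b] [<-] /=.
have [x [off -> tau_v min_x]] := payment_offered valTh def_a.
have fin_tau : tau_at Th [set~ i] x \is a fin_num.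
  by rewrite ge0_fin_numE ?tau_at_ge0 // (le_lt_trans tau_v) ?ltry.
by rewrite -lee_fin fineK //; split=> //; exists x; split=> //.
Qed.

Lemma offered_three_phase Th i x : valid_profile Th -> offered Th i x ->
  (tau_at Th [set~ i] x <= (value (Th i))%:E)%E ->
  exists p, three_phase pi alpha pr Th = Some (Outcome i (dep (Th i)) p).
Proof.
move=> valTh off tau_v; have [tau [b def_a]] := offered_alloc valTh off tau_v.
by eexists; rewrite /three_phase def_a.
Qed.

Lemma price_ge0 Th o : valid_profile Th ->
  three_phase pi alpha pr Th = Some o -> 0 <= price o.
Proof.
by move=> valTh /(three_phase_sale valTh)[_ _ [x [_ + _]]]; rewrite -lee_fin => <-; apply: tau_at_ge0.
Qed.

Definition same_until Th Th' S x : Prop := forall j, j \in S ->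
  (arr_key Th j <= x)%O || (arr_key Th' j <= x)%O -> Th j = Th' j.

Lemma same_until_sym Th Th' S x : same_until Th Th' S x -> same_until Th' Th S x.
Proof. by move=> same j jS; rewrite orbC => /same ->. Qed.

Section SameUntil.
Variables (Th Th' : profile R n) (S : {set 'I_n}) (x : key).
Hypotheses (valTh : valid_profile Th) (valTh' : valid_profile Th').
Hypothesis same : same_until Th Th' S x.

Lemma tau_same y : (y <= x)%O -> tau_at Th S y = tau_at Th' S y.
Proof.
move=> le_yx; apply: tau_local => j.
have lt_ad T : valid_profile T -> (arr_key T j < dep_key T j)%O.
  by move=> valT; apply: arr_lt_dep_key; case: (valT j).
rewrite !in_departed => -[] /andP[jS dep_j]; split=> //; apply: same => //; apply/orP.
  by left; apply/ltW/(lt_le_trans (lt_ad _ valTh))/(le_trans dep_j).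
by right; apply/ltW/(lt_le_trans (lt_ad _ valTh'))/(le_trans dep_j).
Qed.

Lemma claims_same y j : (y <= x)%O -> claims Th S y j = claims Th' S y j.
Proof.
move=> le_yx; rewrite /claims -(tau_same le_yx); case: (boolP (j \in S)) => //= jS.
have [arr_j|arr_j] := boolP ((arr_key Th j <= y)%O || (arr_key Th' j <= y)%O).
  by rewrite /arr_key /dep_key /= same //; case/orP: arr_j => /le_trans-> //; rewrite ?orbT.
by move: arr_j; rewrite negb_or => /andP[/negPf-> /negPf->].
Qed.

Lemma unsold_before_same y : (y <= x)%O -> unsold_before Th S y -> unsold_before Th' S y.
Proof.
move=> le_yx uns z j lt_zy; rewrite -claims_same ?uns //.
exact: le_trans (ltW lt_zy) le_yx.
Qed.

End SameUntil.

(** An offer at [x] depends on the others only through arrivals up to [x], and on [i] only through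
    her interval, which may be widened. *)
Lemma offered_same Th Th' i x : valid_profile Th -> valid_profile Th' ->
  same_until Th Th' [set~ i] x ->
  arr (Th' i) <= arr (Th i) -> dep (Th i) <= dep (Th' i) ->
  offered Th i x -> offered Th' i x.
Proof.
move=> valTh valTh' same le_arr le_dep [/andP[arr_x dep_x] uns first_i]; split.
- by rewrite (le_trans (le_arr_key le_arr)) // (lt_le_trans dep_x) ?le_dep_key.
- exact: (unsold_before_same valTh valTh' same (lexx x)) uns.
- by move=> j; rewrite -(claims_same valTh valTh' same) //; apply: first_i.
Qed.

Lemma truthful_ge0 Th i : valid_profile Th ->
  0 <= utility (Th i) (three_phase pi alpha pr Th) i.
Proof.
move=> valTh; rewrite /utility; case def_o: (three_phase _ _ _ _) => [o|//].
case: eqP => // win_i; have [-> price_v _] := three_phase_sale valTh def_o.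
rewrite win_i in price_v *; rewrite lexx andbT.
by case: (valTh i) => -> _; rewrite subr_ge0.
Qed.

(** A profitable lie sells by her true departure at a price up to her value. The instant behind that
    price is offered under the truth too, at the same threshold, and the truthful price is the least
    offered threshold. *)
Lemma truthful_dominant Th Th' i : valid_profile Th -> valid_profile Th' ->
  (forall j, j != i -> Th j = Th' j) -> arr (Th i) <= arr (Th' i) ->
  utility (Th i) (three_phase pi alpha pr Th') i
    <= utility (Th i) (three_phase pi alpha pr Th) i.
Proof.
move=> valTh valTh' same le_arr; have u_ge0 := truthful_ge0 i valTh.
rewrite {1}/utility; case def_o: (three_phase _ _ _ Th') => [o|//].
case: eqP => // win_i; have p_ge0 := price_ge0 valTh' def_o.
have [-> price_v [x [off tau_x _]]] := three_phase_sale valTh' def_o.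
rewrite win_i in price_v off tau_x *.
(* Delivery is at the reported departure, so overstating it makes the item worthless to her. *)
case: ifP => [/andP[_ le_dep]|_]; last by rewrite (le_trans _ u_ge0) // sub0r oppr_le0.
have same_x y : same_until Th' Th [set~ i] y.
  by move=> j; rewrite !inE => /same->.
have [le_pv|lt_vp] := leP (price o) (value (Th i)); last first.
  by rewrite (le_trans _ u_ge0) // subr_le0 ltW.
have off' : offered Th i x by apply: offered_same off.
have tau_x' : tau_at Th [set~ i] x = (price o)%:E.
  by rewrite -(tau_same valTh' valTh (same_x x)).
have [|p def_p] := offered_three_phase valTh off'; first by rewrite tau_x' lee_fin.
have [_ _ [_ [_ _ min_p]]] := three_phase_sale valTh def_p.
rewrite def_p /utility /= eqxx lexx andbT; case: (valTh i) => -> _.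
by rewrite lerD2l lerN2; have := min_p x off'; rewrite tau_x' lee_fin.
Qed.

Lemma time_strategyproof_three_phase : time_strategyproof (three_phase pi alpha pr).
Proof.
move=> Th i th valTh val_th le_arr; apply: truthful_dominant => //.
- by move=> j; rewrite /report /=; case: eqP => _; [exact: val_th|exact: valTh].
- by move=> j /negPf ne_ji; rewrite /report /= ne_ji.
- by rewrite /report /= eqxx.
Qed.

Lemma time_to_value_strategyproof (M : auction R n) :
  time_strategyproof M -> value_strategyproof M.
Proof.
by move=> spM Th i v valTh v_ge0; apply: spM => //; split=> //; case: (valTh i).
Qed.

(** Delivery is at the winner's departure [t], so all her offers rest on information available at
    [t]. Both profiles make her the same offers, and each price is the minimum over them. *)
Lemma online_three_phase : online (three_phase pi alpha pr).
Proof.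
move=> Th Th' i t p valTh valTh' info def_p.
have [/= def_t price_v [x [off tau_x min_x]]] := three_phase_sale valTh def_p.
have eq_i : Th i = Th' i.
  by apply: info; left; rewrite def_t; case: (valTh i).
have same_x y : (y < dep_key Th i)%O -> same_until Th Th' [set~ i] y.
  move=> /ltW/key_time; rewrite /= -def_t => le_yt j _ arr_j; apply: info.
  by case/orP: arr_j => /key_time/le_trans/(_ le_yt); [left|right].
have dep_x : (x < dep_key Th i)%O by case: off => /andP[].
have off' : offered Th' i x.
  by apply: (offered_same valTh valTh' (same_x x _)) off; rewrite ?eq_i.
have [|p' def_p'] := offered_three_phase valTh' off'.
  by rewrite -(tau_same valTh valTh' (same_x x dep_x)) // tau_x lee_fin -eq_i.
have [/= _ _ [y [off_y tau_y min_y]]] := three_phase_sale valTh' def_p'.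
have dep_y : (y < dep_key Th i)%O by case: off_y => /andP[_]; rewrite /dep_key /= eq_i.
have off_y' : offered Th i y.
  by apply: (offered_same valTh' valTh (same_until_sym (same_x y _))) off_y; rewrite ?eq_i.
rewrite def_p' -eq_i -def_t; congr (Some (Outcome i t _)); apply/le_anti/andP; split.
  have := min_y x off'.
  by rewrite -(tau_same valTh valTh' (same_x x dep_x)) // tau_x lee_fin.
have := min_x y off_y'.
by rewrite (tau_same valTh valTh' (same_x y dep_y)) // tau_y lee_fin.
Qed.

(** * Lower bounds on the revenue of one profile *)

Lemma revenue_ge0 Th : valid_profile Th -> 0 <= revenue (three_phase pi alpha pr Th).
Proof.
move=> valTh; case def_o: (three_phase _ _ _ _) => [o|] //=.
exact: price_ge0 def_o.
Qed.

Lemma claims_revenue Th x i : valid_profile Th -> claims Th [set: 'I_n] x i ->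
  exists w y p, [/\ revenue (three_phase pi alpha pr Th) = p, p <= value (Th w),
    offered Th w y, tau_at Th [set: 'I_n] y = p%:E & (y < dep_key Th w)%O].
Proof.
move=> valTh cl_i; have [o def_o] : exists o, three_phase pi alpha pr Th = Some o.
  rewrite /three_phase.
  case: (allocP [set: 'I_n] valTh) => [e w *|no_claim]; first by eexists.
  by case/negP: (no_claim x i).
have [_ price_v [y [off tau_y _]]] := three_phase_sale valTh def_o.
have dep_y : (y < dep_key Th (winner o))%O by case: off => /andP[].
by exists (winner o), y, (price o); rewrite def_o (tau_others dep_y).
Qed.

Lemma pr_le_tau Th S x : (#|departed Th S x| < k2)%N -> (pr%:E <= tau_at Th S x)%E.
Proof.
rewrite ltnNge /tau_at /tau_after => /negPf->; case: ifP => _; last exact: leey.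
by rewrite lee_fin le_max lexx orbT.
Qed.

(** [h] claims just before leaving, in the second phase, so a sale occurs; the work is to show that
    its price is a threshold from before the third phase. *)
Lemma revenue_consistent Th h : valid_profile Th ->
  (forall j, value (Th j) <= pr) -> value (Th h) = pr ->
  (k1 < rank_in Th [set: 'I_n] h <= k2)%N ->
  pr <= revenue (three_phase pi alpha pr Th).
Proof.
move=> valTh max_pr val_h /andP[gt_k1 le_k2]; have hT := in_setT h.
have pr_ge0 : 0 <= pr by rewrite -val_h; case: (valTh h).
have [x [arr_x dep_x card_x]] := active_before_departure valTh hT.
have x1 : (k1 <= #|departed Th [set: 'I_n] x|)%N by rewrite card_x -ltnS prednK ?rank_in_gt0.
have x2 : (#|departed Th [set: 'I_n] x| < k2)%N by rewrite card_x prednK ?rank_in_gt0.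
have cl_h : claims Th [set: 'I_n] x h.
  rewrite /claims hT arr_x dep_x tau_phase2 // val_h lee_fin ge_max lexx andbT.
  exact: vmax_first_le.
have [w [y [p [-> _ off tau_y dep_y]]]] := claims_revenue valTh cl_h.
rewrite -lee_fin -tau_y pr_le_tau //.
have lt_rank : (#|departed Th [set: 'I_n] y| < rank_in Th [set: 'I_n] w)%N.
  by rewrite ltnNge leq_rank_in ?in_setT // -ltNge.
have [early|late] := leqP (rank_in Th [set: 'I_n] w) k2; first exact: leq_trans early.
have ne_hw : h != w by apply: contraTneq late => <-; rewrite -leqNgt.
(* A winner of rank above [k2] is still present at [x]. Without her, [h] claims at [x], so no offer
   to her comes after [x]. *)
have x_w : (x < dep_key Th w)%O.
  rewrite ltNge -(leq_rank_in _ _ (in_setT w)) -ltnNge.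
  exact: ltn_trans late.
have cl_h' : claims Th [set~ w] x h by rewrite claims_others // ne_hw.
apply: leq_ltn_trans x2; apply: card_departed; rewrite leNgt; apply/negP => lt_xy.
by case: off => _ /(_ x h lt_xy); rewrite cl_h'.
Qed.

(** No finite threshold exceeds the value of [h1], so her last active instant forces a sale. A
    finite price needs [k1] departures, after which thresholds cover the value of [h2]. *)
Lemma revenue_low_prediction Th h1 h2 : valid_profile Th ->
  (forall j, value (Th j) <= value (Th h1)) -> pr <= value (Th h1) ->
  (rank_in Th [set: 'I_n] h2 <= k1 < rank_in Th [set: 'I_n] h1)%N ->
  value (Th h2) <= revenue (three_phase pi alpha pr Th).
Proof.
move=> valTh max_h1 pr_h1 /andP[le_k1 gt_k1].
have vmax_h1 k : vmax_first Th [set: 'I_n] k <= value (Th h1).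
  by apply: vmax_first_le => //; case: (valTh h1).
have [x [arr_x dep_x card_x]] := active_before_departure valTh (in_setT h1).
have x1 : (k1 <= #|departed Th [set: 'I_n] x|)%N by rewrite card_x -ltnS prednK ?rank_in_gt0.
have cl_h : claims Th [set: 'I_n] x h1.
  rewrite /claims in_setT arr_x dep_x /tau_at /tau_after x1 /=.
  by case: ifP => _; rewrite lee_fin ?ge_max ?pr_h1 ?vmax_h1.
have [w [y [p [-> _ _ tau_y _]]]] := claims_revenue valTh cl_h.
have y1 : (k1 <= #|departed Th [set: 'I_n] y|)%N by apply: (@tau_finite _ _ _ p); rewrite tau_y.
rewrite -lee_fin -tau_y /tau_at /tau_after y1.
have le_h2 := value_le_vmax (in_setT h2) le_k1.
case: ifP => _; rewrite lee_fin ?le_max ?le_h2 //.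
exact: le_trans (le_vmax_first _ _ le_k12).
Qed.

(** A price is at most the winner's value, so a prediction above all values rules out second-phase
    prices. The third-phase threshold covers [h2] and is met by [h1]. *)
Lemma revenue_high_prediction Th h1 h2 : valid_profile Th ->
  (forall j, value (Th j) <= value (Th h1)) -> value (Th h1) < pr ->
  (rank_in Th [set: 'I_n] h2 <= k2 < rank_in Th [set: 'I_n] h1)%N ->
  value (Th h2) <= revenue (three_phase pi alpha pr Th).
Proof.
move=> valTh max_h1 pr_h1 /andP[le_k2 gt_k2].
have [x [arr_x dep_x card_x]] := active_before_departure valTh (in_setT h1).
have x2 : (k2 <= #|departed Th [set: 'I_n] x|)%N by rewrite card_x -ltnS prednK ?rank_in_gt0.
have cl_h : claims Th [set: 'I_n] x h1.
  rewrite /claims in_setT arr_x dep_x tau_phase3 // lee_fin.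
  by apply: vmax_first_le => //; case: (valTh h1).
have [w [y [p [-> p_w _ tau_y _]]]] := claims_revenue valTh cl_h.
have y2 : (k2 <= #|departed Th [set: 'I_n] y|)%N.
  rewrite leqNgt; apply/negP => /pr_le_tau; rewrite tau_y lee_fin => le_prp.
  by have := lt_le_trans pr_h1 (le_trans le_prp (le_trans p_w (max_h1 w))); rewrite ltxx.
by rewrite -lee_fin -tau_y tau_phase3 // lee_fin value_le_vmax ?in_setT.
Qed.

End Auction.

(** * Counting matchings *)

Section Matchings.
Variable n : nat.
Implicit Types (s t : 'S_n) (B : {set 'I_n}) (h : 'I_n).

Lemma card_preim_perm s B : (\sum_h (s h \in B) = #|B|)%N.
Proof.
rewrite (reindex_perm s^-1) /= -sum1_card [RHS]big_mkcond; apply: eq_bigr => h _.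
by rewrite permKV; case: (h \in B).
Qed.

(** Both counts follow by double counting, since right translation of [s] makes
    all (pairs of distinct) values equivalent. *)
Lemma count_matching1 B h :
  ((\sum_(s : 'S_n) (s^-1%g h \in B)) * n = n`! * #|B|)%N.
Proof.
have inv h' : (\sum_(s : 'S_n) (s^-1%g h' \in B) = \sum_(s : 'S_n) (s^-1%g h \in B))%N.
  rewrite (reindex_inj (mulIg (tperm h h'))) /=; apply: eq_bigr => s _.
  by rewrite invMg permM tpermV tpermR.
have <- : (\sum_h' \sum_(s : 'S_n) (s^-1%g h' \in B) = (\sum_(s : 'S_n) (s^-1%g h \in B)) * n)%N.
  by rewrite (eq_bigr _ (fun h' _ => inv h')) sum_nat_const card_ord mulnC.
rewrite exchange_big (eq_bigr (fun=> #|B|)) => [|s _]; last exact: card_preim_perm.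
by rewrite sum_nat_const card_Sn.
Qed.

Lemma count_matching2 B1 B2 h1 h2 : [disjoint B1 & B2] -> h1 != h2 ->
  ((\sum_(s : 'S_n) ((s^-1%g h1 \in B1) && (s^-1%g h2 \in B2))) * (n * n.-1)
     = n`! * (#|B1| * #|B2|))%N.
Proof.
move=> disB ne_h; set N := (X in (X * _)%N).
have inv a b : b != a ->
    (\sum_(s : 'S_n) ((s^-1%g a \in B1) && (s^-1%g b \in B2)) = N)%N.
  (* The translation must send [h1] to [a] and [h2] to [b]: after the first swap [h2] sits at [h2'],
     and the second swap fixes [a]. *)
  move=> ne_ba; pose h2' := tperm h1 a h2.
  have ne_h2' : h2' != a by rewrite /h2' -{2}(tpermL h1 a) (inj_eq perm_inj) eq_sym.
  rewrite (reindex_inj (mulIg (tperm h1 a * tperm h2' b)%g)) /=; apply: eq_bigr => s _.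
  rewrite !invMg !permM !tpermV [tperm h2' b b]tpermR [tperm h2' b a]tpermD //.
  by rewrite tpermR /h2' tpermK.
have <- : (\sum_a \sum_(b | b != a) \sum_(s : 'S_n)
      ((s^-1%g a \in B1) && (s^-1%g b \in B2)) = N * (n * n.-1))%N.
  transitivity (\sum_(a < n) \sum_(b | b != a) N)%N.
    by apply: eq_bigr => a _; apply: eq_bigr => b; apply: inv.
  rewrite (eq_bigr (fun=> n.-1 * N)%N) => [|a _].
    by rewrite sum_nat_const card_ord mulnA mulnC.
  by rewrite sum_nat_const cardC1 card_ord.
transitivity (\sum_(s : 'S_n) #|B1| * #|B2|)%N; last by rewrite sum_nat_const card_Sn.
under eq_bigr do rewrite exchange_big.
rewrite exchange_big; apply: eq_bigr => s _.
rewrite -(card_preim_perm s^-1 B1) -(card_preim_perm s^-1 B2) big_distrl /=.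
apply: eq_bigr => a _; rewrite big_distrr /= [RHS](bigD1 a) //=.
(* When [a] contributes, disjointness makes the missing term [b = a] zero. *)
have [aB1|_] := boolP (_ \in B1); last by rewrite !big1.
rewrite (disjointFr disB aB1) muln0 add0n; apply: eq_bigr => b _.
by rewrite mul1n.
Qed.

End Matchings.

(** * Order statistics, phase boundaries and expected revenue *)

Lemma kth_highest_perm (R : realType) n (V : 'I_n -> R) :
  exists p : 'S_n, forall i : 'I_n, kth_highest V i.+1 = V (p i).
Proof.
have /tuple_permP[p def_s] : perm_eq (sort >=%R (codom V)) [tuple V i | i < n].
  by rewrite perm_sort.
exists p => i; rewrite /kth_highest def_s.
by rewrite [nth _ _ _](nth_mktuple (fun i => tnth [tuple V i | i < n] (p i))) tnth_mktuple.
Qed.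

Lemma kth_highest_le (R : realType) n (V : 'I_n -> R) (i j : nat) :
  (i <= j < n)%N -> kth_highest V j.+1 <= kth_highest V i.+1.
Proof.
move=> /andP[le_ij lt_jn].
have size_s : size (sort >=%R (codom V)) = n by rewrite size_sort size_codom card_ord.
have ge_tr : transitive (>=%R : rel R) by move=> ? ? ? /[swap]; apply: le_trans.
have sorted_s : sorted >=%R (sort >=%R (codom V)).
  by apply: sort_sorted => ? ?; apply: le_total.
have lt_in := leq_ltn_trans le_ij lt_jn.
have := sorted_leq_nth ge_tr (fun x => lexx x) 0 sorted_s i j.
by rewrite !inE size_s; apply.
Qed.

(** Membership in [W] makes rounding void: the boundaries are [k] and [k + m], where [m] is
    [alpha * n]. *)
Lemma W_starts (R : realType) n (alpha : R) : W n alpha ->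
  [/\ (second_start alpha n)%:R = (1 - alpha) / 2 * n%:R,
      (third_start alpha n)%:R = (1 + alpha) / 2 * n%:R,
      (second_start alpha n <= third_start alpha n)%N &
      (second_start alpha n + third_start alpha n = n)%N].
Proof.
case=> /andP[a0 _] /natrP[m def_m] /natrP[k def_k].
have def_km : (1 + alpha) / 2 * n%:R = (k + m)%:R.
  by rewrite natrD -def_k -def_m; field.
have -> : second_start alpha n = k.
  by rewrite /second_start def_k pmulrn intrKceil.
have -> : third_start alpha n = (k + m)%N.
  by rewrite /third_start def_km pmulrn intrKfloor.
rewrite def_k def_km leq_addr; split=> //; apply/eqP; rewrite -(eqr_nat R).
by rewrite natrD -def_km -def_k; apply/eqP; field.
Qed.

Lemma expected_revenue_ge (R : realType) n (M : auction R n) (V : 'I_n -> R)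
    (I : 'I_n -> R * R) (P : pred 'S_n) (u : R) :
  (forall s, 0 <= revenue (M (matching V I s))) ->
  (forall s, P s -> u <= revenue (M (matching V I s))) ->
  (\sum_s P s)%:R / n`!%:R * u <= expected_revenue M V I.
Proof.
move=> rev_ge0 rev_ge; rewrite mulrAC /expected_revenue.
apply: ler_wpM2r; first by rewrite invr_ge0 ler0n.
rewrite natr_sum mulr_suml; apply: ler_sum => s _.
by case: (boolP (P s)) => [/rev_ge|_]; rewrite ?mul1r ?mul0r.
Qed.

Lemma card_rank_between (R : realType) n (pi : 'S_n) (Th : profile R n) (k k' : nat) :
  (k <= k' <= n)%N ->
  #|[set i | (k < rank_in pi Th [set: 'I_n] i <= k')%N]| = (k' - k)%N.
Proof.
move=> /andP[le_k le_k']; pose B c := [set i in [set: 'I_n] | (rank_in pi Th [set: 'I_n] i <= c)%N].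
have cardB c : (c <= n)%N -> #|B c| = c.
  by move=> le_c; rewrite card_rank_in_le // cardsT card_ord.
have -> : [set i | (k < rank_in pi Th [set: 'I_n] i <= k')%N] = B k' :\: B k.
  by apply/setP => i; rewrite !inE -ltnNge.
rewrite cardsD (setIidPr _) ?cardB // ?(leq_trans le_k) //.
by apply/subsetP => i; rewrite !inE => /leq_trans->.
Qed.

Lemma matching_valid (R : realType) n (V : 'I_n -> R) (I : 'I_n -> R * R) (s : 'S_n) :
  valid_values V -> valid_intervals I -> valid_profile (matching V I s).
Proof. by move=> valV valI i; split; [apply: valI | apply: valV]. Qed.

(** * Consistency and robustness *)

Lemma three_phase_consistency (R : realType) (n : nat) (pi : 'S_n) (alpha : R) :
  (0 < n)%N -> W n alpha -> (alpha%:E <= consistency (three_phase pi alpha))%E.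
Proof.
move=> n_gt0 /W_starts[def_k1 def_k2 le_k12 add_k12].
apply: le_ereal_inf_tmp => _ [V [I [valV valI v1_gt0 ->]]].
rewrite lee_fin ler_pdivlMr //; set v1 := kth_highest V 1 in v1_gt0 *.
have [p def_V] := kth_highest_perm V; pose h := p (Ordinal n_gt0).
have val_h : V h = v1 by rewrite -def_V.
have le_v1 i : V i <= v1.
  rewrite -(permKV p i) -def_V; apply: kth_highest_le; exact: ltn_ord.
set k1 := second_start alpha n in def_k1 le_k12 add_k12.
set k2 := third_start alpha n in def_k2 le_k12 add_k12.
(* Departure ranks depend on the intervals only, so they can be read off the
   identity matching. *)
pose B := [set i | (k1 < rank_in pi (matching V I 1) [set: 'I_n] i <= k2)%N].
have cardB : #|B| = (k2 - k1)%N by apply: card_rank_between; rewrite le_k12 -add_k12 leq_addl.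
apply: le_trans (@expected_revenue_ge R n (three_phase pi alpha v1) V I
  (fun s => s^-1%g h \in B) v1 _ _) => [|s|s]; last 2 first.
- by apply: revenue_ge0 => //; apply: matching_valid.
- rewrite inE => rank_h; apply: (@revenue_consistent _ _ _ _ _ le_k12 _ (s^-1%g h)) => //.
  + exact: matching_valid.
  + by move=> j; apply: le_v1.
  + by rewrite /= permKV.
rewrite ler_wpM2r ?(ltW v1_gt0) // ler_pdivlMr ?ltr0n ?fact_gt0 //.
have n0 : n%:R != 0 :> R by rewrite pnatr_eq0 -lt0n.
(* The event has probability [(k2 - k1) / n], which is [alpha]. *)
have := congr1 (fun c => c%:R : R) (count_matching1 B h).
rewrite !natrM cardB natrB // def_k1 def_k2 => count_eq.
by rewrite -(ler_pM2r (_ : 0 < n%:R)) ?ltr0n // count_eq le_eqVlt; apply/orP; left; apply/eqP; field.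
Qed.

Lemma three_phase_robustness (R : realType) (n : nat) (pi : 'S_n) (alpha : R) :
  (0 < n)%N -> W n alpha ->
  (((1 - alpha ^+ 2) / 4)%:E <= robustness (three_phase pi alpha))%E.
Proof.
move=> n_gt0 /W_starts[def_k1 def_k2 le_k12 add_k12].
apply: le_ereal_inf_tmp => _ [V [I [pr [valV valI pr_ge0 v2_gt0 ->]]]].
rewrite lee_fin ler_pdivlMr //; set v2 := kth_highest V 2 in v2_gt0 *.
(* With fewer than two bidders [nth] returns its default 0, against [v2_gt0]. *)
have n_gt1 : (1 < n)%N.
  rewrite ltnNge; apply: contraTN v2_gt0 => le_n1.
  by rewrite /v2 /kth_highest nth_default ?ltxx // size_sort size_codom card_ord.
(* [p] lists the indices by decreasing value, so [h1] and [h2] are distinct even if the top values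
   tie. *)
have [p def_V] := kth_highest_perm V.
pose h1 := p (Ordinal n_gt0); pose h2 := p (Ordinal n_gt1).
have val_h2 : V h2 = v2 by rewrite -def_V.
have le_v1 i : V i <= V h1.
  rewrite -(permKV p i) -!def_V; apply: kth_highest_le; exact: ltn_ord.
have ne_h : h1 != h2 by rewrite (inj_eq perm_inj).
set k1 := second_start alpha n in def_k1 le_k12 add_k12.
set k2 := third_start alpha n in def_k2 le_k12 add_k12.
pose rank := rank_in pi (matching V I 1) [set: 'I_n].
have rank_gt0 i : (0 < rank i)%N by apply/rank_in_gt0/in_setT.
have rank_le i : (rank i <= n)%N by rewrite -[leqRHS]card_ord max_card.
have card_le k : (k <= n)%N -> #|[set i | (rank i <= k)%N]| = k.
  move=> le_k; rewrite -[RHS]subn0 -(card_rank_between pi (matching V I 1)) //=.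
  by apply: eq_card => i; rewrite !inE rank_gt0.
have card_gt k : (k <= n)%N -> #|[set i | (k < rank i)%N]| = (n - k)%N.
  move=> le_k; rewrite -(card_rank_between pi (matching V I 1)) ?le_k ?leqnn //.
  by apply: eq_card => i; rewrite !inE rank_le andbT.
(* Each prediction regime needs a cut [k] separating the two ranks, at [k1] or at [k2]; as these add
   up to [n], both cuts have the same probability. *)
have [k [le_kn card_k good]] : exists k, [/\ (k <= n)%N, (k * (n - k) = k1 * k2)%N &
  forall s : 'S_n, (rank (s^-1%g h2) <= k < rank (s^-1%g h1))%N ->
    v2 <= revenue (three_phase pi alpha pr (matching V I s))].
  have valM s : valid_profile (matching V I s) by apply: matching_valid.
  have valE s i : value (matching V I s (s^-1%g i)) = V i by rewrite /= permKV.
  have [pr_le|pr_gt] := leP pr (V h1).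
    exists k1; split=> [||s ranks]; rewrite -?add_k12 ?leq_addr ?addKn //.
    rewrite -val_h2 -(valE s h2).
    by apply: (revenue_low_prediction le_k12 (valM s) _ _ ranks); rewrite valE // => j; apply: le_v1.
  exists k2; split=> [||s ranks]; rewrite -?add_k12 ?leq_addl ?addnK ?[(k2 * _)%N]mulnC //.
  rewrite -val_h2 -(valE s h2).
  by apply: (revenue_high_prediction le_k12 (valM s) _ _ ranks); rewrite valE // => j; apply: le_v1.
pose B1 := [set i | (k < rank i)%N]; pose B2 := [set i | (rank i <= k)%N].
have disB : [disjoint B1 & B2].
  by rewrite disjoint_subset; apply/subsetP => i; rewrite !inE -ltnNge.
apply: le_trans (@expected_revenue_ge R n (three_phase pi alpha pr) V I
  (fun s => (s^-1%g h1 \in B1) && (s^-1%g h2 \in B2)) v2 _ _) => [|s|s]; last 2 first.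
- by apply: revenue_ge0 => //; apply: matching_valid.
- by rewrite !inE => /andP[gt_k le_k]; apply: good; rewrite le_k.
rewrite ler_wpM2r ?(ltW v2_gt0) // ler_pdivlMr ?ltr0n ?fact_gt0 //.
have := congr1 (fun c => c%:R : R) (count_matching2 disB ne_h).
rewrite card_le // card_gt // [((n - k) * k)%N]mulnC card_k !natrM def_k1 def_k2.
set N := (X in X * _ = _) => count_eq.
have nn_gt0 : 0 < n%:R * n.-1%:R :> R by rewrite mulr_gt0 // ltr0n // -ltnS prednK.
have n_R : 0 < n%:R :> R by rewrite ltr0n.
rewrite -(ler_pM2r nn_gt0) count_eq.
have -> : n`!%:R * ((1 - alpha) / 2 * n%:R * ((1 + alpha) / 2 * n%:R))
   = (1 - alpha ^+ 2) / 4 * n`!%:R * (n%:R * n%:R) :> R by field.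
have [coef_ge0 fact_ge0] : 0 <= (1 - alpha ^+ 2) / 4 /\ 0 <= n`!%:R :> R.
  split=> //; have -> : (1 - alpha ^+ 2) / 4 = k1%:R * k2%:R / (n%:R * n%:R).
    by rewrite def_k1 def_k2; field; rewrite gt_eqF.
  by rewrite divr_ge0 // mulr_ge0.
(* The exact probability has denominator [n * (n - 1)]; bounding [n - 1] by [n] gives the
   constant. *)
apply: ler_wpM2l; first exact: mulr_ge0.
by apply: ler_wpM2l; rewrite ?(ltW n_R) // ler_nat leq_pred.
Qed.

Theorem theorem2 (R : realType) (n : nat) (pi : 'S_n) (alpha : R) :
  (0 < n)%N -> W n alpha ->
  [/\ forall pr : R, 0 <= pr -> value_strategyproof (three_phase pi alpha pr),
      forall pr : R, 0 <= pr -> time_strategyproof (three_phase pi alpha pr),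
      forall pr : R, 0 <= pr -> online (three_phase pi alpha pr),
      (alpha%:E <= consistency (three_phase pi alpha))%E &
      (((1 - alpha ^+ 2) / 4)%:E <= robustness (three_phase pi alpha))%E].
Proof.
move=> n_gt0 W_alpha; have [_ _ le_k12 _] := W_starts W_alpha; split.
- by move=> pr _; apply/time_to_value_strategyproof/time_strategyproof_three_phase.
- by move=> pr _; apply: time_strategyproof_three_phase.
- by move=> pr _; apply: online_three_phase.
- exact: three_phase_consistency.
- exact: three_phase_robustness.
Qed.
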